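(* Let $w_1,\dots,w_n$ be positive real numbers and let $H_{\mathfrak W}=\prod_{k=1}^n\{0,w_k\}\subseteq\mathbb R^n$, equipped with the $\ell^1$ metric. Suppose that $(X=\{\boldsymbol x_0,\dots,\boldsymbol x_m\},d)$ is a metric subspace of $H_{\mathfrak W}$. Then the following conditions are equivalent for each $\boldsymbol\xi=(\xi_0,\dots,\xi_m)^T\in F_0$: (i) $\sum_{k=0}^m\xi_k\boldsymbol x_k=\boldsymbol 0$. (ii) $\langle D_X\boldsymbol\xi,\boldsymbol\xi\rangle=0$. (iii) $D_X\boldsymbol\xi=\boldsymbol 0$.
   Context: $D_X=(\|\boldsymbol x_i-\boldsymbol x_j\|_1)_{i,j=0}^m$ is the distance matrix of $X$, $\langle\cdot,\cdot\rangle$ is the usual inner product, and $F_0=\{\boldsymbol\xi\in\mathbb R^{m+1}:\sum_{i=0}^m\xi_i=0\}$. *)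

(* Defs.v *)
From mathcomp Require Import all_boot all_order all_algebra.
From mathcomp Require Import reals.

Set Implicit Arguments.
Unset Strict Implicit.
Unset Printing Implicit Defensive.

Import Order.TTheory GRing.Theory Num.Theory.

Local Open Scope ring_scope.

(* The norm that MathComp-Analysis puts on matrices is the sup norm, hence an
   explicit l^1 distance. *)
Definition l1dist (R : realType) (n : nat) (x y : 'cV[R]_n) : R :=
  \sum_(k < n) `|x k 0 - y k 0|.

Definition inner (R : realType) (n : nat) (u v : 'cV[R]_n) : R :=
  \sum_(i < n) u i 0 * v i 0.

Definition weighted_cube (R : realType) (n : nat) (w : 'I_n -> R) :
    {pred 'cV[R]_n} :=
  [pred x : 'cV[R]_n | [forall k, x k 0 \in [:: 0; w k]]].

Definition distance_matrix (R : realType) (n m : nat)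
    (x : 'I_m.+1 -> 'cV[R]_n) : 'M[R]_m.+1 :=
  \matrix_(i, j) l1dist (x i) (x j).

Definition F0 (R : realType) (m : nat) : {pred 'cV[R]_m.+1} :=
  [pred xi : 'cV[R]_m.+1 | \sum_(i < m.+1) xi i 0 == 0].

Arguments F0 : clear implicits.

(* Main.v *)
Require Import Defs.
From mathcomp Require Import all_boot all_order all_algebra.
From mathcomp Require Import reals.
From mathcomp Require Import ring.

Set Implicit Arguments.
Unset Strict Implicit.
Unset Printing Implicit Defensive.

Import Order.TTheory GRing.Theory Num.Theory.

Local Open Scope ring_scope.

(** Write s = sum_k xi_k x_k. For a, b in {0, w} the distance |a - b| is the
    polynomial a + b - 2ab/w, so each coordinate of the cube contributes to D_X
    two terms depending on one index only and a matrix of rank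
    at most one. When the
    entries of xi sum to zero, the term depending only on the row index
    disappears from D_X xi, which leaves an expression linear in s
    ([distance_matrix_mulE]); pairing with xi removes the other one as well, and

      < D_X xi, xi > = - 2 sum_k s_k^2 / w_k        ([inner_distance_matrixE]).

    As the weights are positive, this quadratic form vanishes only for s = 0
    ([inner_distance_matrix_eq0]), while s = 0 makes D_X xi vanish by
    linearity. *)

Lemma dist_two_points (R : realType) (w a b : R) : 0 < w ->
  a \in [:: 0; w] -> b \in [:: 0; w] -> `|a - b| = a + b - 2 * a * b / w.
Proof.
move=> w_gt0; have w_neq0 : w != 0 by rewrite gt_eqF.
rewrite !inE => /orP[] /eqP-> /orP[] /eqP->.
- by rewrite subrr normr0; ring.
- by rewrite sub0r normrN gtr0_norm //; ring.
- by rewrite subr0 gtr0_norm //; ring.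
- by rewrite subrr normr0; field.
Qed.

Section CubeSubset.

Variables (R : realType) (n m : nat) (w : 'I_n -> R).
Hypothesis w_gt0 : forall k, 0 < w k.
Variable x : 'I_m.+1 -> 'cV[R]_n.
Hypothesis x_cube : forall i, x i \in weighted_cube w.
Variable xi : 'cV[R]_m.+1.
Hypothesis xi_F0 : xi \in F0 R m.

Let s : 'cV[R]_n := \sum_(k < m.+1) xi k 0 *: x k.

Lemma combinationE k : s k 0 = \sum_j xi j 0 * x j k 0.
Proof. by rewrite summxE; apply: eq_bigr => j _; rewrite mxE. Qed.

Lemma distance_matrix_mulE i :
  (distance_matrix x *m xi) i 0 = \sum_k (1 - 2 * x i k 0 / w k) * s k 0.
Proof.
have /eqP xi_sum0 : \sum_j xi j 0 == 0 by move: xi_F0; rewrite inE.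
rewrite mxE.
under eq_bigr => j _ do rewrite mxE mulr_suml.
rewrite exchange_big; apply: eq_bigr => k _.
have cubeP j : x j k 0 \in [:: 0; w k].
  by move: (x_cube j); rewrite inE => /forallP.
(* The first summand is the row term, killed by the condition on xi. *)
transitivity (\sum_j (x i k 0 * xi j 0
                      + (1 - 2 * x i k 0 / w k) * (xi j 0 * x j k 0))).
  by apply: eq_bigr => j _; rewrite (dist_two_points (w_gt0 k)) //; ring.
by rewrite big_split /= -!mulr_sumr xi_sum0 mulr0 add0r combinationE.
Qed.

Lemma inner_distance_matrixE :
  inner (distance_matrix x *m xi) xi = - (2 * \sum_k s k 0 ^+ 2 / w k).
Proof.
have /eqP xi_sum0 : \sum_j xi j 0 == 0 by move: xi_F0; rewrite inE.
rewrite /inner.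
under eq_bigr => i _ do rewrite distance_matrix_mulE mulr_suml.
rewrite exchange_big mulr_sumr -sumrN; apply: eq_bigr => k _.
transitivity (\sum_i (s k 0 * xi i 0
                      + - (2 * s k 0 / w k) * (xi i 0 * x i k 0))).
  by apply: eq_bigr => i _; ring.
by rewrite big_split /= -!mulr_sumr xi_sum0 -combinationE; ring.
Qed.

Lemma inner_distance_matrix_eq0 :
  inner (distance_matrix x *m xi) xi = 0 -> s = 0.
Proof.
rewrite inner_distance_matrixE => /eqP.
rewrite oppr_eq0 mulf_eq0 pnatr_eq0 /= psumr_eq0; last first.
  by move=> k _; rewrite divr_ge0 ?sqr_ge0 // ltW.
move=> /allP sq0; apply/matrixP => k j; rewrite ord1 mxE; apply/eqP.
have := sq0 k (mem_index_enum k).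
by rewrite /= mulf_eq0 invr_eq0 (gt_eqF (w_gt0 k)) orbF sqrf_eq0.
Qed.

Lemma distance_matrix_mul_eq0 : s = 0 -> distance_matrix x *m xi = 0.
Proof.
move=> s0; apply/matrixP => i j; rewrite ord1 distance_matrix_mulE mxE s0.
by rewrite big1 // => k _; rewrite mxE mulr0.
Qed.

End CubeSubset.

Lemma inner0l (R : realType) (p : nat) (v : 'cV[R]_p) : inner 0 v = 0.
Proof. by rewrite /inner big1 // => i _; rewrite mxE mul0r. Qed.

Theorem theorem6p5 (R : realType) (n m : nat)
  (w : 'I_n -> R) (w_gt0 : forall k : 'I_n, 0 < w k)
  (x : 'I_m.+1 -> 'cV[R]_n) (x_inj : injective x)
  (x_cube : forall i : 'I_m.+1, x i \in weighted_cube w)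
  (xi : 'cV[R]_m.+1) (xi_F0 : xi \in F0 R m) :
  [<-> \sum_(k < m.+1) xi k 0 *: x k = 0;
       inner (distance_matrix x *m xi) xi = 0;
       distance_matrix x *m xi = 0].
Proof.
have form0 := inner_distance_matrix_eq0 w_gt0 x_cube xi_F0.
have mul0 := distance_matrix_mul_eq0 w_gt0 x_cube xi_F0.
tfae.
- by move=> /mul0->; apply: inner0l.
- by move=> /form0/mul0.
- by move=> D0; apply: form0; rewrite D0 inner0l.
Qed.
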